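(* The antipode of the Hopf monoid of building sets $\mathbf{BS}$ is given by the following cancellation-free expression. If $\mathcal B$ is a building set on $I$ then $$\mathsf s_I(\mathcal B)=\sum_{\mathcal B\text{-forests }\mathcal N}(-1)^{|\mathcal N|}\,\mathcal B(\mathcal N),$$ where for each $\mathcal B$-forest $\mathcal N$, $|\mathcal N|$ is the number of vertices of $\mathcal N$ and $\mathcal B(\mathcal N)=\bigsqcup_{S\text{ node of }\mathcal N}\mathcal B[\mathcal N_{<S},\mathcal N_{\le S}]$.
   Context: A building set on a finite set $I$ is a collection $\mathcal B$ of subsets of $I$ such that $\{i\}\in\mathcal B$ for all $i\in I$, and if $J,K\in\mathcal B$ with $J\cap K\ne\emptyset$ then $J\cup K\in\mathcal B$; by convention $\emptyset\in\mathcal B$. Its connected components are its maximal sets; they partition $I$. $\mathrm{BS}[I]$ is the set of building sets on $I$, and $\mathbf{BS}[I]$ is the vector space with basis $\mathrm{BS}[I]$ over a field of characteristic $0$. For an ordered decomposition $I=S\sqcup T$, the product of $\mathcal B_1\in\mathrm{BS}[S]$ and $\mathcal B_2\in\mathrm{BS}[T]$ is $\mathcal B_1\sqcup\mathcal B_2$ (union, with a single $\emptyset$), and the coproduct is $\Delta_{S,T}(\mathcal B)=\mathcal B|_S\otimes\mathcal B/_S$, where $\mathcal B|_S=\{B\in\mathcal B:B\subseteq S\}$ and $\mathcal B/_S=\{B\subseteq T:A\sqcup B\in\mathcal B\text{ for some }A\subseteq S\}$. These make $\mathbf{BS}$ a connected Hopf monoid. With $\mu_{S_1,\dots,S_k},\Delta_{S_1,\dots,S_k}$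 the iterated (co)products, the antipode is $\mathsf s_\emptyset=\mathrm{id}$ and, for $I\neq\emptyset$, $\mathsf s_I=\sum(-1)^k\mu_{S_1,\dots,S_k}\circ\Delta_{S_1,\dots,S_k}$, over all $k\ge1$ and ordered sequences of nonempty pairwise disjoint $S_1,\dots,S_k$ with union $I$. A $\mathcal B$-forest $\mathcal N$ is a rooted forest whose vertices (nodes) are labeled with nonempty sets partitioning $I$ (nodes are identified with their labels), partially ordered by $\le$ with all branches directed up towards the roots (so roots are maximal), such that, writing $\mathcal N_{\le S}=\bigsqcup_{T\le S}T$ and $\mathcal N_{<S}=\bigsqcup_{T<S}T$: (F1) for any node $S$, $\mathcal N_{\le S}\in\mathcal B$; (F2) if $S_1,\dots,S_k$ are pairwise incomparable nodes and $k\ge2$, then $\bigcup_{i=1}^k\mathcal N_{\le S_i}\notin\mathcal B$; (F3) if $R_1,\dots,R_r$ are the roots of $\mathcal N$, then $\mathcal N_{\le R_1},\dots,\mathcal N_{\le R_r}$ are precisely the connected components of $\mathcal B$. For $X\subseteq Y\subseteq I$, $\mathcal B[X,Y]:=(\mathcal B|_Y)/_X$, a building set on $Y-X$. Thus $\mathcal B(\mathcal N)$ is a building set on $I$. An expression $\sum_\alpha c_\alpha x_\alpha$ in basis elements is cancellation-free if no $\alpha\ne\beta$ have $x_\alpha=x_\beta$ with $c_\alpha,c_\beta$ of opposite sign. *)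

(* Defs.v *)
From HB Require Import structures.
From mathcomp Require Import all_boot all_order all_algebra.
Set Implicit Arguments.
Unset Strict Implicit.
Unset Printing Implicit Defensive.
Import Order.TTheory GRing.Theory Num.Theory.
Local Open Scope ring_scope.

(* Finite sets are the subsets of an ambient finite type T.                   *)

Definition building (T : finType) (I : {set T}) (B : {set {set T}}) : bool :=
  [&& [forall J in B, J \subset I],
      set0 \in B,
      [forall i in I, [set i] \in B]
    & [forall J in B, forall K in B, (J :&: K != set0) ==> (J :|: K \in B)]].

Lemma buildingP (T : finType) (I : {set T}) (B : {set {set T}}) :
  reflect [/\ forall J, J \in B -> J \subset I,
              set0 \in B,
              forall i, i \in I -> [set i] \in B
            & forall J K, J \in B -> K \in B -> J :&: K != set0 ->
                J :|: K \in B]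
          (building I B).
Proof.
apply: (iffP and4P) => [[/forall_inP h1 h2 /forall_inP h3 /forall_inP h4]|].
  split=> // J K JB KB JK.
  by move: (h4 J JB) => /forall_inP/(_ K KB)/implyP/(_ JK).
move=> [h1 h2 h3 h4]; split=> //; apply/forall_inP => // J JB.
by apply/forall_inP => K KB; apply/implyP; exact: h4.
Qed.

Definition BS (T : finType) (I : {set T}) : finType :=
  {B : {set {set T}} | building I B}.

(* Maximal sets; nonemptiness only matters for I = set0, where B = [set set0] *)
(* has no connected component.                                                *)
Definition components (T : finType) (B : {set {set T}}) : {set {set T}} :=
  [set J | (J != set0) && maxset (fun K => K \in B) J].

Definition restriction (T : finType) (B : {set {set T}}) (S : {set T}) :
    {set {set T}} :=
  [set J in B | J \subset S].

(* [contraction B S R] is B/_S for a decomposition of the ground set into S   *)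
(* and R.                                                                     *)
Definition contraction (T : finType) (B : {set {set T}}) (S R : {set T}) :
    {set {set T}} :=
  [set J : {set T} | (J \subset R) &&
     [exists A : {set T}, (A \subset S) && (A :|: J \in B)]].

(* B[X, Y] *)
Definition interval_BS (T : finType) (B : {set {set T}}) (X Y : {set T}) :
    {set {set T}} :=
  contraction (restriction B Y) X (Y :\: X).

Definition decomposition (T : finType) (I S R : {set T}) : bool :=
  (S :|: R == I) && [disjoint S & R].

Lemma restriction_building (T : finType) (I S : {set T}) (B : {set {set T}}) :
  S \subset I -> building I B -> building S (restriction B S).
Proof.
move=> sSI /buildingP[h1 h2 h3 h4]; apply/buildingP; split.
- by move=> J; rewrite inE => /andP[].
- by rewrite inE h2 sub0set.
- by move=> i iS; rewrite inE h3 ?sub1set ?iS // (subsetP sSI).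
- move=> J K; rewrite !inE => /andP[JB JS] /andP[KB KS] JK.
  by rewrite h4 //= subUset JS.
Qed.

Lemma contraction_building (T : finType) (I S R : {set T})
    (B : {set {set T}}) :
  R \subset I -> building I B -> building R (contraction B S R).
Proof.
move=> sRI /buildingP[h1 h2 h3 h4]; apply/buildingP; split.
- by move=> J; rewrite inE => /andP[].
- rewrite inE sub0set; apply/existsP; exists set0.
  by rewrite sub0set setU0.
- move=> i iR; rewrite inE sub1set iR; apply/existsP; exists set0.
  by rewrite sub0set set0U h3 // (subsetP sRI).
- move=> J K; rewrite !inE => /andP[JR /existsP[A /andP[AS AJ]]].
  move=> /andP[KR /existsP[C /andP[CS CK]]] JK.
  rewrite subUset JR KR; apply/existsP; exists (A :|: C).
  rewrite subUset AS CS /= setUACA h4 //.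
  apply: contraNneq JK => e; rewrite -subset0 -e.
  by apply: setISS; apply: subsetUr.
Qed.

Lemma product_building (T : finType) (I S R : {set T})
    (B C : {set {set T}}) :
  decomposition I S R -> building S B -> building R C -> building I (B :|: C).
Proof.
move=> /andP[/eqP <- dSR] /buildingP[b1 b2 b3 b4] /buildingP[c1 c2 c3 c4].
have nm J K : J \in B -> K \in C -> J :&: K = set0.
  move=> /b1 JS /c1 KR; apply/eqP; rewrite setI_eq0.
  exact: disjointWl JS (disjointWr KR dSR).
apply/buildingP; split.
- move=> J; rewrite inE => /orP[/b1|/c1] h; apply: subset_trans h _.
    exact: subsetUl.
  exact: subsetUr.
- by rewrite inE b2.
- by move=> i; rewrite !inE => /orP[/b3|/c3] ->; rewrite ?orbT.
- move=> J K; rewrite !inE => /orP[JB|JC] /orP[KB|KC] JK.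
  + by rewrite b4.
  + by rewrite nm ?eqxx in JK.
  + by rewrite setIC nm ?eqxx in JK.
  + by rewrite c4 ?orbT.
Qed.

Lemma decomposition_subl (T : finType) (I S R : {set T}) :
  decomposition I S R -> S \subset I.
Proof. by move=> /andP[/eqP <- _]; apply: subsetUl. Qed.

Lemma decomposition_subr (T : finType) (I S R : {set T}) :
  decomposition I S R -> R \subset I.
Proof. by move=> /andP[/eqP <- _]; apply: subsetUr. Qed.

Definition BS_product (T : finType) (I S R : {set T})
    (d : decomposition I S R) (BC : BS S * BS R) : BS I :=
  exist _ (val BC.1 :|: val BC.2)
    (product_building d (valP BC.1) (valP BC.2)).

Definition BS_coproduct (T : finType) (I S R : {set T})
    (d : decomposition I S R) (B : BS I) : BS S * BS R :=
  (exist _ (restriction (val B) S)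
     (restriction_building (decomposition_subl d) (valP B)),
   exist _ (contraction (val B) S R)
     (contraction_building S (decomposition_subr d) (valP B))).

Definition set_composition (T : finType) (I : {set T}) (s : seq {set T}) :
    bool :=
  [&& set0 \notin s,
      pairwise (fun A C : {set T} => [disjoint A & C]) s
    & \bigcup_(A <- s) A == I].

Lemma set_composition_head (T : finType) (I S : {set T}) (s : seq {set T}) :
  set_composition I (S :: s) -> decomposition I S (\bigcup_(A <- s) A).
Proof.
case/and3P => _ /= /andP[/allP dS _]; rewrite big_cons /decomposition => ->.
rewrite bigcup_seq; apply: bigcup_disjoint => A As.
exact: dS.
Qed.

Lemma set_composition_tail (T : finType) (I S : {set T}) (s : seq {set T}) :
  set_composition I (S :: s) -> set_composition (\bigcup_(A <- s) A) s.
Proof.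
case/and3P => /= n0 /andP[_ ps] _; rewrite /set_composition ps eqxx /= andbT.
by apply: contra n0 => h; rewrite inE h orbT.
Qed.

(* This justifies the range of k in [antipode]. *)
Lemma set_composition_size (T : finType) (I : {set T}) (s : seq {set T}) :
  set_composition I s -> (size s <= #|I|)%N.
Proof.
elim: s I => [|S s IH] I //= c.
have h := IH _ (set_composition_tail c).
have /andP[/eqP <- d] := set_composition_head c.
have/and3P[n0 _ _] := c.
rewrite cardsU; move: d; rewrite -setI_eq0 => /eqP ->; rewrite cards0 subn0.
rewrite -add1n leq_add // card_gt0; apply: contraNneq n0 => ->.
by rewrite inE eqxx.
Qed.

Lemma unit_building (T : finType) (I : {set T}) :
  set_composition I [::] -> building I [set set0].
Proof.
case/and3P => _ _; rewrite big_nil => /eqP <-; apply/buildingP; split.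
- by move=> J; rewrite inE => /eqP ->; apply: sub0set.
- by rewrite inE.
- by move=> i; rewrite inE.
- by move=> J K; rewrite !inE => /eqP -> /eqP ->; rewrite setI0 eqxx.
Qed.

(* Basis of the tensor product BS[S_1] (x) ... (x) BS[S_k], s = S_1 ... S_k   *)
Fixpoint BS_tensor (T : finType) (s : seq {set T}) : finType :=
  if s is A :: s' then (BS A * BS_tensor s')%type else unit.

(* The iterated operations, with the unit and the counit of the connected     *)
(* Hopf monoid as the case k = 0.                                             *)
Fixpoint BS_iter_product (T : finType) (s : seq {set T}) :
    forall I : {set T}, set_composition I s -> BS_tensor s -> BS I :=
  match s with
  | [::] => fun I c _ => exist _ [set set0] (unit_building c)
  | _ :: s' => fun I c x =>
      BS_product (set_composition_head c)
        (x.1, BS_iter_product (set_composition_tail c) x.2)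
  end.

Fixpoint BS_iter_coproduct (T : finType) (s : seq {set T}) :
    forall I : {set T}, set_composition I s -> BS I -> BS_tensor s :=
  match s with
  | [::] => fun I c _ => tt
  | _ :: s' => fun I c B =>
      let BC := BS_coproduct (set_composition_head c) B in
      (BC.1, BS_iter_coproduct (set_composition_tail c) BC.2)
  end.

(* The vector space over K with basis X, and its basis vectors.               *)
Definition freeVect (K : fieldType) (X : finType) : lmodType K :=
  {ffun X -> K^o}.

Definition basis_vect (K : fieldType) (X : finType) (x : X) : freeVect K X :=
  [ffun y => (y == x)%:R].

Definition linearize (K : fieldType) (X Y : finType) (f : X -> Y)
    (v : freeVect K X) : freeVect K Y :=
  \sum_(x : X) (v : {ffun X -> K^o}) x *: basis_vect K (f x).

(* The product and the coproduct of BS are the linear extensions of set-level *)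
(* maps, hence so are their iterates.                                         *)
Definition mu_iter (K : fieldType) (T : finType) (I : {set T})
    (s : seq {set T}) (c : set_composition I s) :
    freeVect K (BS_tensor s) -> freeVect K (BS I) :=
  linearize (BS_iter_product c).

Definition Delta_iter (K : fieldType) (T : finType) (I : {set T})
    (s : seq {set T}) (c : set_composition I s) :
    freeVect K (BS I) -> freeVect K (BS_tensor s) :=
  linearize (BS_iter_coproduct c).

Definition antipode (K : fieldType) (T : finType) (I : {set T})
    (v : freeVect K (BS I)) : freeVect K (BS I) :=
  if I == set0 then v else
  \sum_(1 <= k < #|I|.+1)
    \sum_(s : {s : k.-tuple {set T} | set_composition I s})
      (-1) ^+ k *: mu_iter (valP s) (Delta_iter (valP s) v).

(* A directed graph on nodes labelled by (and identified with) subsets of T;  *)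
(* an edge (S, R) says that R is the parent of S.                             *)
Definition setgraph (T : finType) : finType :=
  ({set {set T}} * {set {set T} * {set T}})%type.

Definition nodes (T : finType) (N : setgraph T) : {set {set T}} := N.1.
Definition edges (T : finType) (N : setgraph T) : {set {set T} * {set T}} :=
  N.2.

Definition node_le (T : finType) (N : setgraph T) : rel {set T} :=
  connect [rel S R | (S, R) \in edges N].

Definition node_lt (T : finType) (N : setgraph T) : rel {set T} :=
  [rel S R | (S != R) && node_le N S R].

Definition rooted_forest (T : finType) (N : setgraph T) : bool :=
  [&& edges N \subset setX (nodes N) (nodes N),
      [forall S, forall R, forall R',
         ((S, R) \in edges N) && ((S, R') \in edges N) ==> (R == R')]
    & [forall S, forall R, ((S, R) \in edges N) ==> ~~ node_le N R S]].

Definition roots (T : finType) (N : setgraph T) : {set {set T}} :=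
  [set R in nodes N | [forall S, (R, S) \notin edges N]].

Definition down_le (T : finType) (N : setgraph T) (S : {set T}) : {set T} :=
  \bigcup_(R in nodes N | node_le N R S) R.

Definition down_lt (T : finType) (N : setgraph T) (S : {set T}) : {set T} :=
  \bigcup_(R in nodes N | node_lt N R S) R.

Definition pairwise_incomparable (T : finType) (N : setgraph T)
    (A : {set {set T}}) : bool :=
  [forall S in A, forall R in A,
     (S != R) ==> ~~ node_le N S R && ~~ node_le N R S].

Definition forest_F1 (T : finType) (B : {set {set T}}) (N : setgraph T) :=
  [forall S in nodes N, down_le N S \in B].

Definition forest_F2 (T : finType) (B : {set {set T}}) (N : setgraph T) :=
  [forall A : {set {set T}},
     [&& A \subset nodes N, (2 <= #|A|)%N & pairwise_incomparable N A] ==>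
     (\bigcup_(S in A) down_le N S \notin B)].

Definition forest_F3 (T : finType) (B : {set {set T}}) (N : setgraph T) :=
  [set down_le N R | R in roots N] == components B.

Definition is_Bforest (T : finType) (I : {set T}) (B : {set {set T}})
    (N : setgraph T) : bool :=
  [&& rooted_forest N, partition (nodes N) I,
      forest_F1 B N, forest_F2 B N & forest_F3 B N].

Definition Bforest (T : finType) (I : {set T}) (B : BS I) : finType :=
  {N : setgraph T | is_Bforest I (val B) N}.

Lemma bigproduct_building (T : finType) (I : {set T}) (P : {set {set T}})
    (C : {set T} -> {set {set T}}) :
  partition P I -> (forall S, S \in P -> building S (C S)) ->
  building I (set0 |: \bigcup_(S in P) C S).
Proof.
case/and3P => /eqP <- tP _ bC; apply/buildingP; split.
- move=> J; rewrite !inE => /orP[/eqP -> |/bigcupP[S SP JS]].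
    exact: sub0set.
  have /buildingP[/(_ J JS) h _ _ _] := bC S SP.
  exact: subset_trans h (bigcup_sup S SP).
- by rewrite !inE eqxx.
- move=> i /bigcupP[S SP iS]; rewrite !inE; apply/orP; right.
  by apply/bigcupP; exists S => //; have /buildingP[_ _ ->] := bC S SP.
- move=> J K; rewrite !inE => /orP[/eqP ->|/bigcupP[S SP JS]].
    by rewrite set0I eqxx.
  move=> /orP[/eqP ->|/bigcupP[R RP KR]]; first by rewrite setI0 eqxx.
  have /buildingP[b1 _ _ b4] := bC S SP.
  have /buildingP[c1 _ _ _] := bC R RP.
  move=> /set0Pn[x /setIP[xJ xK]]; apply/orP; right.
  have eSR : S = R.
    rewrite -(def_pblock tP SP (subsetP (b1 J JS) x xJ)).
    by rewrite (def_pblock tP RP (subsetP (c1 K KR) x xK)).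
  apply/bigcupP; exists S => //; apply: b4; rewrite // ?eSR //.
  by apply/set0Pn; exists x; rewrite inE xJ.
Qed.

Lemma down_leD (T : finType) (I : {set T}) (N : setgraph T) (S : {set T}) :
  partition (nodes N) I -> S \in nodes N -> down_le N S :\: down_lt N S = S.
Proof.
case/and3P => _ tN _ SN; apply/setP => x; rewrite inE; apply/andP/idP.
- case=> xlt /bigcupP[R /andP[RN RS] xR].
  case: (eqVneq R S) => [<- //|nRS]; case/negP: xlt.
  by apply/bigcupP; exists R; rewrite ?RN ?/node_lt /= ?nRS.
- move=> xS; split.
    apply/bigcupP => -[R /and3P[RN /eqP nRS _] xR]; apply: nRS.
    by rewrite -(def_pblock tN RN xR) (def_pblock tN SN xS).
  by apply/bigcupP; exists S => //; rewrite SN /node_le connect0.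
Qed.

(* The initial set0 only matters for the empty forest on I = set0. *)
Definition forest_sets (T : finType) (B : {set {set T}}) (N : setgraph T) :
    {set {set T}} :=
  set0 |: \bigcup_(S in nodes N) interval_BS B (down_lt N S) (down_le N S).

Lemma forest_sets_building (T : finType) (I : {set T}) (B : BS I)
    (N : Bforest B) : building I (forest_sets (val B) (val N)).
Proof.
case: N => N /= /and5P[_ pN _ _ _]; apply: bigproduct_building (pN) _ => S SN.
rewrite /interval_BS (down_leD pN SN).
have sub R : R \in nodes N -> R \subset I.
  by case/and3P: pN => /eqP <- _ _ RN; exact: (bigcup_sup R RN).
apply: (@contraction_building _ (down_le N S)).
  by apply: (bigcup_sup S) => //; rewrite SN /node_le connect0.
apply: restriction_building (valP B).
by apply/bigcupsP => R /andP[/sub].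
Qed.

(* B(N) *)
Definition forest_BS (T : finType) (I : {set T}) (B : BS I) (N : Bforest B) :
    BS I :=
  exist _ (forest_sets (val B) (val N)) (forest_sets_building N).

(* (-1)^|N|; an integer, so that its sign makes sense *)
Definition forest_coef (T : finType) (I : {set T}) (B : BS I)
    (N : Bforest B) : int :=
  (-1) ^+ #|nodes (val N)|.

Definition cancellation_free (A : finType) (X : eqType) (c : A -> int)
    (x : A -> X) : Prop :=
  forall a b : A, a != b -> x a = x b -> ~ (c a * c b < 0).

(* Main.v *)
Require Import Defs.
From mathcomp Require Import all_boot all_order all_algebra.
Set Implicit Arguments.
Unset Strict Implicit.
Unset Printing Implicit Defensive.
Import Order.TTheory GRing.Theory Num.Theory.
Local Open Scope ring_scope.

(** A B-forest N is determined by the family M of the sets N_{<=S}: the node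
    S is N_{<=S} minus the union of the smaller members of M, and the edges are
    the covering relations of M for inclusion.  The families that arise are the
    nested sets of B: they lie in B, avoid the empty set, contain the connected
    components, and any nonempty subfamily whose union is in B contains that
    union ([nested]; the bijection is [down_setsK] and [forest_ofK]).  Hence
    the right-hand side is the sum of (-1)^|M| B(M) over nested sets M
    ([sum_Bforests]).

    Call this sum F(B).  Splitting off the last block of a composition, the
    alternating sum defining the antipode satisfies, for nonempty I, the
    recursion s(B) = - sum of s(B|_S) . B/_S over proper subsets S of I, so it
    suffices that F obeys the same recursion, that is, that the sum of
    F(B|_S) . B/_S over all subsets S of I vanishes ([nested_sum_eq0]).  A term
    of this sum is given by S and a nested set M of B|_S; the union of M is S,
    so M alone is enough.  Two facts make everything collapse: M is nested for
    the restriction of B to its union exactly when M together with the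
    components of B is nested for B ([nested_restriction]), and the product of
    (B|_S)(M) and B/_S is then B(M with the components added)
    ([nested_sets_restriction]).  Both the condition and the basis element
    depend only on M up to components of B, whereas the sign depends on |M|;
    adding or removing one fixed component is a sign-reversing involution.

    The expression is cancellation-free because the nodes of N are the
    connected components of B(N) ([components_forest_sets]): forests with the
    same B(N) have the same number of nodes. *)

(** * Building sets and their components *)

Section Building.
Variables (T : finType) (I : {set T}) (B : {set {set T}}).
Hypothesis bB : building I B.

Lemma componentsP (J : {set T}) :
  J \in components B ->
  [/\ J != set0, J \in B & forall K, K \in B -> J \subset K -> K = J].
Proof.
by rewrite inE => /andP[J0 /maxsetP[JB Jmax]]; split=> // K KB; apply: Jmax.
Qed.

Lemma component_exists (J : {set T}) :
  J \in B -> J != set0 -> exists2 c, c \in components B & J \subset c.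
Proof.
move=> JB J0; have [c cmax Jc] := @maxset_exists _ (fun K => K \in B) J JB.
exists c => //; rewrite inE cmax andbT.
by apply: contraNneq J0 => c0; rewrite -subset0 -c0.
Qed.

(** The union of a component and a member of B meeting it is again in B, so
    it is the component, by maximality. *)
Lemma component_absorb (c K : {set T}) :
  c \in components B -> K \in B -> K :&: c != set0 -> K \subset c.
Proof.
have /buildingP[_ _ _ joinB] := bB.
move=> /componentsP[_ cB cmax] KB /(joinB _ _ KB cB) KcB.
by rewrite -(cmax _ KcB (subsetUr _ _)) subsetUl.
Qed.

Lemma building_join_cover (J : {set T}) (A : {set {set T}}) :
  J \in B -> A \subset B -> (forall K, K \in A -> K :&: J != set0) ->
  J :|: cover A \in B.
Proof.
have /buildingP[_ _ _ joinB] := bB.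
move=> JB /subsetP AB meet; rewrite /cover.
elim/big_rec: _ => [|K X KA IH]; first by rewrite setU0.
rewrite setUCA joinB ?(AB K) //; apply: contraNneq (meet K KA) => KJX.
by rewrite -subset0 -KJX setIS ?subsetUl.
Qed.

End Building.

(** * Nested sets *)

(** The last clause is the antichain condition on forests in disguise: an
    antichain with at least two members never contains its union, and the
    maximal members of a family have the same union as the family.  In this form
    it can be applied to families that are not antichains. *)
Definition nested (T : finType) (B M : {set {set T}}) : bool :=
  [&& M \subset B, set0 \notin M, components B \subset M
    & [forall A : {set {set T}},
        [&& A \subset M, A != set0 & cover A \in B] ==> (cover A \in A)]].

Lemma nestedP (T : finType) (B M : {set {set T}}) :
  reflect [/\ M \subset B, set0 \notin M, components B \subset M
            & forall A : {set {set T}}, A \subset M -> A != set0 ->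
                cover A \in B -> cover A \in A]
          (nested B M).
Proof.
apply: (iffP and4P) => -[MB M0 compM closedM]; split=> //.
  by move=> A AM A0 AB; have:= forallP closedM A; rewrite AM A0 AB.
by apply/forallP => A; apply/implyP => /and3P[]; apply: closedM.
Qed.

Definition lower (T : finType) (M : {set {set T}}) (J : {set T}) : {set T} :=
  cover [set K in M | K \proper J].

Definition node (T : finType) (M : {set {set T}}) (J : {set T}) : {set T} :=
  J :\: lower M J.

(** The building set B(N) of the forest N whose down-sets are the members of
    M. *)
Definition nested_sets (T : finType) (B M : {set {set T}}) : {set {set T}} :=
  set0 |: \bigcup_(J in M) interval_BS B (lower M J) J.

Lemma lowerP (T : finType) (M : {set {set T}}) (J : {set T}) (x : T) :
  reflect (exists K, [/\ K \in M, K \proper J & x \in K]) (x \in lower M J).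
Proof.
apply: (iffP bigcupP) => [[K]|[K [KM KJ xK]]].
  by rewrite inE => /andP[KM KJ] xK; exists K.
by exists K; rewrite // inE KM.
Qed.

Lemma lower_sub (T : finType) (M : {set {set T}}) (J : {set T}) :
  lower M J \subset J.
Proof. by apply/subsetP => x /lowerP[K [_ /proper_sub/subsetP KJ /KJ]]. Qed.

Lemma nested_coverE (T : finType) (I : {set T}) (B M : {set {set T}}) :
  building I B -> nested B M -> cover M = I.
Proof.
move=> /[dup] bB /buildingP[subI _ ptB _].
case/nestedP => /subsetP MB _ /subsetP compM _; apply/setP => x.
apply/bigcupP/idP => [[J /MB/subI/subsetP JI /JI] //|xI].
have x0 : [set x] != set0 by apply/set0Pn; exists x; rewrite inE.
have [c /compM cM] := component_exists (ptB x xI) x0.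
by rewrite sub1set => xc; exists c.
Qed.

(** * The cancellation *)

Section Recursion.
Variables (T : finType) (I : {set T}) (B : {set {set T}}).
Hypothesis bB : building I B.

(** From left to right: a family that uses a component c outside M and whose
    union lies in B has union c, by maximality of c.  From right to left: a
    component J of the restriction to the union of M is covered by the members
    of M that meet it; the union of those members is in B, hence in M, and
    contains J, hence equals J. *)
Lemma nested_restriction (M : {set {set T}}) :
  nested (restriction B (cover M)) M = nested B (M :|: components B).
Proof.
apply/nestedP/nestedP => [[MB M0 _ closedM]|[MB M0 _ closedM]].
  have {}MB : M \subset B.
    by apply: subset_trans MB _; apply/subsetP => J; rewrite inE => /andP[].
  split.
  - rewrite subUset MB; apply/subsetP => c.
    by case/componentsP.
  - by rewrite inE negb_or M0 inE eqxx.
  - exact: subsetUr.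
  - move=> A AM A0 AB; have [AsubM|] := boolP (A \subset M).
      apply: closedM => //; rewrite inE AB.
      by apply/bigcupsP => J /(subsetP AsubM) JM; apply: (bigcup_sup J).
    case/subsetPn => c cA cM; have := subsetP AM c cA.
    rewrite inE (negPf cM) => /componentsP[_ _ cmax].
    by rewrite (cmax _ AB) //; apply: (bigcup_sup c).
have subM : M \subset M :|: components B by apply: subsetUl.
have JS J : J \in M -> J \subset cover M by move=> JM; apply: (bigcup_sup J).
have JB J : J \in M -> J \in B by move/(subsetP subM)/(subsetP MB).
split.
- by apply/subsetP => J JM; rewrite inE JB ?JS.
- by apply: contra M0; apply/subsetP.
- apply/subsetP => J /componentsP[J0]; rewrite inE => /andP[JinB JsubS] Jmax.
  pose A := [set K in M | K :&: J != set0].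
  have AM : A \subset M by apply/subsetP => K; rewrite inE => /andP[].
  have JA : J \subset cover A.
    apply/subsetP => x xJ; have /bigcupP[K KM xK] := subsetP JsubS x xJ.
    apply/bigcupP; exists K => //; rewrite inE KM.
    by apply/set0Pn; exists x; rewrite inE xK.
  have A0 : A != set0.
    apply: contraNneq J0 => A0; rewrite -subset0; apply: subset_trans JA _.
    by rewrite A0 /cover big_set0.
  have AB : cover A \in B.
    rewrite -(setUidPr JA); apply: building_join_cover bB _ _ JinB _ _.
      by apply/subsetP => K /(subsetP AM)/JB.
    by move=> K; rewrite inE => /andP[].
  have {}AM := subsetP AM _ (closedM A (subset_trans AM subM) A0 AB).
  by rewrite -(Jmax (cover A)) // inE AB JS.
- move=> A AM A0; rewrite inE => /andP[AB _].
  by apply: closedM => //; apply: subset_trans subM.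
Qed.

(** Passing from M to M' by adding components changes no lower part.  The
    pieces of B(M') at the members of M are those of (B|_S)(M), and the pieces
    at the added components make up B/_S: if A is in S and the union of A and H
    is in B, this union lies in one component c; when H is nonempty c is not in
    M, so that c meets S in its lower part only and A lies there. *)
Lemma nested_sets_restriction (M : {set {set T}}) (S := cover M) :
  nested B (M :|: components B) ->
  nested_sets (restriction B S) M :|: contraction B S (I :\: S) =
  nested_sets B (M :|: components B).
Proof.
have /buildingP[subI _ _ _] := bB.
set M' := M :|: _ => /nestedP[/subsetP MB _ _ _].
have JS J : J \in M -> J \subset S by move=> JM; apply: (bigcup_sup J).
have lowM J K : J \in M' -> K \in M' -> K \proper J -> K \in M.
  move=> /MB JB; rewrite inE => /orP[//|/componentsP[_ _ Kmax]] KJ.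
  by move: (KJ); rewrite (Kmax J JB (proper_sub KJ)) properxx.
have lowerE J : J \in M -> lower M J = lower M' J.
  move=> JM; congr cover; apply/setP => K; rewrite !inE.
  have [KJ|] := boolP (K \proper J); rewrite ?andbF // !andbT.
  apply/idP/idP => [-> //|KM']; apply: (lowM J) => //; first by rewrite inE JM.
  by rewrite !inE.
have restrE J : J \in M -> restriction (restriction B S) J = restriction B J.
  move=> /JS sJ; apply/setP => K; rewrite !inE -andbA.
  case: (K \in B) => //=; apply/andP/idP => [[] //|KJ]; split=> //.
  exact: subset_trans sJ.
have lowerS J : J \in M' -> lower M' J \subset S.
  move=> JM'; apply/subsetP => x /lowerP[K [KM' KJ xK]].
  by apply: (subsetP (JS K _)) => //; apply: lowM KJ.
(* A component outside M meets S exactly in its lower part. *)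
have compS c : c \in components B -> c \notin M -> c :&: S \subset lower M' c.
  move=> cC cM; apply/subsetP => x /setIP[xc /bigcupP[K KM xK]].
  have KM' : K \in M' by rewrite inE KM.
  apply/lowerP; exists K; split=> //; rewrite properEneq.
  rewrite (component_absorb bB cC (MB K KM')) ?andbT; last first.
    by apply/set0Pn; exists x; rewrite inE xK.
  by apply: contraNneq cM => <-.
apply/setP => H; apply/idP/idP.
  rewrite !inE -orbA => /or3P[-> //|/bigcupP[J JM]|].
    rewrite /interval_BS restrE // lowerE // => HJ; apply/orP; right.
    by apply/bigcupP; exists J; rewrite // inE JM.
  case/andP => HI /existsP[A /andP[AS AHB]].
  have [//|H0 /=] := eqVneq H set0.
  have [|c cC AHc] := component_exists AHB.
    by apply: contraNneq H0 => AH0; rewrite -subset0 -AH0 subsetUr.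
  have [Ac Hc] : A \subset c /\ H \subset c by apply/andP; rewrite -subUset.
  have HS x : x \in H -> x \notin S.
    by move=> /(subsetP HI); rewrite inE => /andP[].
  have cM : c \notin M.
    apply: contraNN H0 => /JS cS; rewrite -subset0; apply/subsetP => x xH.
    by have := HS x xH; rewrite (subsetP cS) ?(subsetP Hc).
  have cM' : c \in M' by rewrite inE cC orbT.
  apply/bigcupP; exists c => //; rewrite inE; apply/andP; split.
    apply/subsetP => x xH; rewrite inE (subsetP Hc) // andbT.
    by apply: contra (HS x xH); apply/subsetP/lowerS.
  apply/existsP; exists A; rewrite inE AHB AHc !andbT.
  by apply: subset_trans (compS c cC cM); rewrite subsetI Ac.
rewrite !inE => /orP[-> //|/bigcupP[J JM' HJ]].
have [JM|JM] := boolP (J \in M).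
  apply/orP; left; apply/orP; right; apply/bigcupP; exists J => //.
  by rewrite /interval_BS restrE // lowerE.
have JC : J \in components B by move: JM'; rewrite inE (negPf JM).
apply/orP; right; move: HJ; rewrite inE => /andP[HJ /existsP[A]].
rewrite inE => /and3P[AJ AHB AHJ]; apply/andP; split.
  apply/subsetP => x /(subsetP HJ); rewrite !inE => /andP[xlow xJ].
  rewrite (subsetP (subI J (MB J JM'))) // andbT.
  by apply: contra xlow => xS; apply: (subsetP (compS J JC JM)); rewrite inE xJ.
by apply/existsP; exists A; rewrite AHB (subset_trans AJ) ?lowerS.
Qed.

(** The outer sum disappears since S must be the union of M; then the terms
    for M and for M with the component c added cancel.  An arbitrary function
    phi of the resulting building set takes the place of basis vectors: this
    lets the product with a fixed building set be absorbed in phi. *)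
Lemma nested_sum_eq0 (R : pzRingType) (phi : {set {set T}} -> R) :
  I != set0 ->
  \sum_(S : {set T} | S \subset I) \sum_(M | nested (restriction B S) M)
     (-1) ^+ #|M| *
     phi (nested_sets (restriction B S) M :|: contraction B S (I :\: S)) = 0.
Proof.
have /buildingP[subI _ ptB _] := bB.
case/set0Pn => x xI; have x0 : [set x] != set0.
  by apply/set0Pn; exists x; rewrite inE.
have [c cC _] := component_exists (ptB x xI) x0.
pose M' (M : {set {set T}}) := M :|: components B.
transitivity (\sum_(M | nested B (M' M))
                (-1) ^+ #|M| * phi (nested_sets B (M' M))).
  rewrite (exchange_big_dep (fun M => nested B (M' M))) /=; last first.
    move=> S M SI nM; rewrite /M' -nested_restriction.
    by rewrite (nested_coverE (restriction_building SI bB) nM).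
  apply: eq_bigr => M nM.
  rewrite (big_pred1 (cover M)) => [|S].
    by rewrite nested_sets_restriction.
  apply/andP/eqP => [[SI /(nested_coverE (restriction_building SI bB)) //]|->].
  split; last by rewrite nested_restriction.
  apply/bigcupsP => J JM; apply: subI.
  by case/nestedP: nM => /subsetP MB _ _ _; apply: MB; rewrite inE JM.
have M'c M : M' (c |: M) = M' M.
  by rewrite /M' -setUA (setUidPr _) // sub1set inE cC orbT.
(* Pair each M without c with c |: M. *)
rewrite (bigID (fun M : {set {set T}} => c \in M)) /=.
rewrite (reindex_onto (fun M => c |: M) (fun M => M :\ c)) /=; last first.
  by move=> M /andP[_]; apply: setD1K.
rewrite (eq_bigl (fun M => nested B (M' M) && (c \notin M)))
  => [|M]; last first.
  rewrite M'c setU11 andbT; congr (_ && _); apply/eqP/idP => [<-|cM].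
    by rewrite !inE eqxx.
  by rewrite setU1K.
rewrite -big_split big1 //= => M /andP[_ cM].
by rewrite M'c cardsU1 cM exprS mulN1r mulNr addNr.
Qed.

End Recursion.

(** * Forests as nested sets *)

Definition covers (T : finType) (M : {set {set T}}) (J K : {set T}) : bool :=
  [&& J \in M, K \in M, J \proper K
    & [forall L in M, ~~ ((J \proper L) && (L \proper K))]].

Definition forest_of (T : finType) (M : {set {set T}}) : setgraph T :=
  (node M @: M,
   [set e | [exists J, exists K, covers M J K && (e == (node M J, node M K))]]).

Definition down_sets (T : finType) (N : setgraph T) : {set {set T}} :=
  down_le N @: nodes N.

Lemma coversP (T : finType) (M : {set {set T}}) (J K : {set T}) :
  reflect [/\ J \in M, K \in M, J \proper K
            & forall L, L \in M -> J \proper L -> L \subset K -> L = K]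
          (covers M J K).
Proof.
apply: (iffP and4P) => -[JM KM JK min]; split=> //.
  move=> L LM JL LK; have [//|] := boolP (L \proper K).
    by move=> LpK; have /forall_inP/(_ L LM) := min; rewrite JL LpK.
  by rewrite properEneq LK andbT negbK => /eqP.
apply/forall_inP => L LM; apply/negP => /andP[JL LK].
by have := LK; rewrite (min L LM JL (proper_sub LK)) properxx.
Qed.

Lemma covers_exists (T : finType) (M : {set {set T}}) (J K : {set T}) :
  J \in M -> K \in M -> J \proper K ->
  exists2 L, covers M J L & L \subset K.
Proof.
move=> JM KM JK.
pose P := [pred L : {set T} | [&& L \in M, J \proper L & L \subset K]].
have PK : P K by rewrite /= KM JK subxx.
case: (arg_minnP (fun L : {set T} => #|L|) PK) => L /and3P[LM JL LK] min.
exists L => //; apply/coversP; split=> // L' L'M JL' L'L.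
apply/eqP; rewrite eqEcard L'L min //=.
by rewrite L'M JL' (subset_trans L'L).
Qed.

Section ForestToNested.
Variables (T : finType) (I : {set T}) (B : {set {set T}}) (N : setgraph T).
Hypothesis forestN : is_Bforest I B N.

Lemma node_le_edge (S R : {set T}) :
  node_le N S R -> S != R ->
  exists2 S', (S, S') \in edges N & node_le N S' R.
Proof.
case/connectP => -[|S' p] /=; first by move=> _ ->; rewrite eqxx.
by case/andP => SS' path_p R_last _; exists S' => //; apply/connectP; exists p.
Qed.

Lemma node_le_anti (S R : {set T}) :
  node_le N S R -> node_le N R S -> S = R.
Proof.
have /and5P[/and3P[_ _ /forallP acyclic] _ _ _ _] := forestN.
move=> SR RS; apply/eqP; apply: contraT => /(node_le_edge SR)[S' SS' S'R].
have /forallP/(_ S')/implyP/(_ SS')/negP := acyclic S.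
by case; apply: connect_trans RS.
Qed.

Lemma node_disjoint (S R : {set T}) (x : T) :
  S \in nodes N -> R \in nodes N -> x \in S -> x \in R -> S = R.
Proof.
have /and5P[_ /and3P[_ tN _] _ _ _] := forestN.
by move=> SN RN xS xR; rewrite -(def_pblock tN SN xS) (def_pblock tN RN xR).
Qed.

Lemma sub_down_le (S : {set T}) : S \in nodes N -> S \subset down_le N S.
Proof.
by move=> SN; apply: (bigcup_sup S); rewrite // SN /node_le connect0.
Qed.

(** The nodes are disjoint and nonempty, so inclusion of down-sets forces an
    element of S into a node below R, and that node must be S. *)
Lemma down_le_sub (S R : {set T}) : S \in nodes N ->
  (down_le N S \subset down_le N R) = node_le N S R.
Proof.
have /and5P[_ /and3P[_ _ n0] _ _ _] := forestN.
move=> SN; apply/idP/idP => [sub|SR]; last first.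
  apply/bigcupsP => Q /andP[QN QS]; apply: (bigcup_sup Q) => //.
  by rewrite QN; apply: connect_trans SR.
have /set0Pn[x xS] : S != set0 by apply: contraNneq n0 => <-.
have SR := subset_trans (sub_down_le SN) sub.
have /bigcupP[Q /andP[QN QR] xQ] := subsetP SR x xS.
by rewrite (node_disjoint SN QN xS xQ).
Qed.

Lemma down_le_inj : {in nodes N &, injective (down_le N)}.
Proof.
by move=> S R SN RN e; apply: node_le_anti; rewrite -down_le_sub // e.
Qed.

Lemma down_le_proper (S R : {set T}) : S \in nodes N -> R \in nodes N ->
  (down_le N S \proper down_le N R) = node_lt N S R.
Proof.
move=> SN RN; rewrite properEneq down_le_sub // /node_lt /=; congr (~~ _ && _).
by apply/eqP/eqP => [|->//]; apply: down_le_inj.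
Qed.

Lemma lower_down_sets (S : {set T}) : S \in nodes N ->
  lower (down_sets N) (down_le N S) = down_lt N S.
Proof.
move=> SN; apply/setP => x; apply/lowerP/bigcupP.
  case=> _ [/imsetP[R RN ->]]; rewrite down_le_proper //.
  case/andP => nRS RS /bigcupP[Q /andP[QN QR] xQ]; exists Q => //.
  rewrite QN /node_lt /= andbC.
  apply/andP; split; first exact: connect_trans RS.
  apply: contraNneq nRS => QS; apply/eqP/node_le_anti => //.
  by rewrite -QS.
case=> R /andP[RN RS] xR; exists (down_le N R); split.
- exact: imset_f.
- by rewrite down_le_proper.
- exact: (subsetP (sub_down_le RN)).
Qed.

Lemma node_down_sets (S : {set T}) : S \in nodes N ->
  node (down_sets N) (down_le N S) = S.
Proof.
have /and5P[_ pN _ _ _] := forestN.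
by move=> SN; rewrite /node lower_down_sets // (down_leD pN).
Qed.

(** As a node has at most one parent, every node strictly above S is above the
    parent of S; so the parent is the only node covering S. *)
Lemma covers_down_sets (S R : {set T}) : S \in nodes N -> R \in nodes N ->
  covers (down_sets N) (down_le N S) (down_le N R) = ((S, R) \in edges N).
Proof.
have /and5P[/and3P[_ /forallP uniq /forallP acyclic] _ _ _ _] := forestN.
have /and5P[/and3P[/subsetP sub _ _] _ _ _ _] := forestN.
move=> SN RN; apply/coversP/idP => [[_ _]|SR].
  rewrite down_le_proper // => /andP[nSR SleR] min.
  have [S' SS' S'R] := node_le_edge SleR nSR.
  have S'N : S' \in nodes N by have := sub _ SS'; rewrite inE => /andP[].
  have nSS' : S != S'.
    have /forallP/(_ S')/implyP/(_ SS') := acyclic S.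
    by apply: contraNneq => ->; apply: connect0.
  rewrite -(down_le_inj S'N RN (min _ _ _ _)) //.
  - exact: imset_f.
  - by rewrite down_le_proper // /node_lt /= nSS'; apply: connect1.
  - by rewrite down_le_sub.
split; rewrite ?imset_f //.
  rewrite down_le_proper // /node_lt /=.
  apply/andP; split; last exact: connect1.
  have /forallP/(_ R)/implyP/(_ SR) := acyclic S.
  by apply: contraNneq => ->; apply: connect0.
move=> _ /imsetP[Q QN ->]; rewrite down_le_proper // down_le_sub //.
case/andP => nSQ SQ QR; have [S' SS' S'Q] := node_le_edge SQ nSQ.
have := forallP (forallP (uniq S) S') R; rewrite SS' SR => /eqP S'R.
by rewrite (node_le_anti QR) // -S'R.
Qed.

Lemma down_setsK : forest_of (down_sets N) = N.
Proof.
have /and5P[/and3P[/subsetP sub _ _] _ _ _ _] := forestN.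
rewrite [RHS]surjective_pairing; congr pair.
  apply/setP => S; apply/imsetP/idP => [[_ /imsetP[R RN ->] ->]|SN].
    by rewrite node_down_sets.
  by exists (down_le N S); rewrite ?node_down_sets ?imset_f.
apply/setP => -[S R]; rewrite inE; apply/existsP/idP.
  case=> J /existsP[K /andP[JK /eqP e]].
  have /coversP[/imsetP[S' S'N J_eq] /imsetP[R' R'N K_eq] _ _] := JK.
  move: JK e; rewrite J_eq K_eq covers_down_sets // !node_down_sets //.
  by move=> ? [-> ->].
move=> SR; have := sub _ SR; rewrite inE /= => /andP[SN RN].
exists (down_le N S); apply/existsP; exists (down_le N R).
by rewrite covers_down_sets // !node_down_sets // eqxx andbT.
Qed.

(** For a family of down-sets whose union is in B, the maximal members form an
    antichain with the same union; by (F2) there is only one of them, and it is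
    the union. *)
Lemma down_sets_nested : nested B (down_sets N).
Proof.
have /and5P[_ /and3P[_ _ n0] /forall_inP F1 /forallP F2 /eqP F3] := forestN.
apply/nestedP; split.
- by apply/subsetP => _ /imsetP[S SN ->]; apply: F1.
- apply/negP => /imsetP[S SN e]; have := sub_down_le SN.
  by rewrite -e subset0 => /eqP S0; rewrite S0 (negPf n0) in SN.
- rewrite -F3; apply/subsetP => J /imsetP[S]; rewrite inE => /andP[SN _] ->.
  exact: imset_f.
move=> A AD A0 AB.
pose top J := (J \in A) && [forall K in A, (J \subset K) ==> (K == J)].
have topE J : J \in A -> exists2 K, top K & J \subset K.
  move=> JA.
  have [K /maxsetP[KA Kmax] JK] := @maxset_exists _ (fun K => K \in A) J JA.
  exists K => //; rewrite /top KA; apply/forall_inP => L LA.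
  by apply/implyP => KL; rewrite (Kmax L).
pose A' := [set S in nodes N | top (down_le N S)].
have coverA : cover A = \bigcup_(S in A') down_le N S.
  apply/setP => x; apply/bigcupP/bigcupP => -[].
    move=> J /topE[K topK JK] xJ; have /imsetP[S SN K_eq] : K \in down_sets N.
      by apply: (subsetP AD); case/andP: topK.
    by exists S; rewrite -?K_eq ?(subsetP JK) // inE SN -K_eq.
  by move=> S; rewrite inE => /and3P[_ SA _] xS; exists (down_le N S).
have antichain : pairwise_incomparable N A'.
  apply/forall_inP => S; rewrite inE => /and3P[SN SA /forall_inP Smax].
  apply/forall_inP => R; rewrite inE => /and3P[RN RA /forall_inP Rmax].
  apply/implyP => nSR; rewrite -!down_le_sub //; apply/andP; split.
    apply: contra nSR => SR; have /implyP/(_ SR)/eqP := Smax _ RA.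
    by move/down_le_inj => ->.
  apply: contra nSR => RS; have /implyP/(_ RS)/eqP := Rmax _ SA.
  by move/down_le_inj => ->.
have := F2 A'; rewrite antichain -coverA AB andbT implybF negb_and -ltnNge ltnS.
have -> /= : A' \subset nodes N by apply/subsetP => S; rewrite inE => /andP[].
have [J JA] := set0Pn _ A0; have [K topK _] := topE J JA.
have /imsetP[S SN K_eq] : K \in down_sets N.
  by apply: (subsetP AD); case/andP: topK.
have SA' : S \in A' by rewrite inE SN -K_eq.
have KA : K \in A by case/andP: topK.
move=> cardA'; have /cards1P[S' A'_eq] : #|A'| == 1.
  by rewrite eqn_leq cardA' card_gt0; apply/set0Pn; exists S.
move: SA'; rewrite coverA A'_eq big_set1 inE => /eqP <-; rewrite -K_eq //.
Qed.

Lemma card_down_sets : #|down_sets N| = #|nodes N|.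
Proof. exact: card_in_imset down_le_inj. Qed.

Lemma nested_sets_down_sets : nested_sets B (down_sets N) = forest_sets B N.
Proof.
rewrite /nested_sets /forest_sets big_imset; last exact: down_le_inj.
by congr (_ |: _); apply: eq_bigr => S SN; rewrite lower_down_sets.
Qed.

End ForestToNested.

Section NestedToForest.
Variables (T : finType) (I : {set T}) (B M : {set {set T}}).
Hypotheses (bB : building I B) (nestedM : nested B M).

(** If J and K meet, their union is in B, so it is J or K. *)
Lemma nested_laminar (J K : {set T}) (x : T) : J \in M -> K \in M ->
  x \in J -> x \in K -> (J \subset K) || (K \proper J).
Proof.
have /buildingP[_ _ _ joinB] := bB.
have /nestedP[/subsetP MB _ _ closedM] := nestedM.
move=> JM KM xJ xK; have := closedM [set J; K].
rewrite subUset !sub1set JM KM /cover bigcup_setU !big_set1 !inE => /(_ isT) c.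
have /orP[/eqP/setUidPl KJ|/eqP/setUidPr JK] : (J :|: K == J) || (J :|: K == K).
- apply: c; first by apply/set0Pn; exists J; rewrite !inE eqxx.
  by apply: joinB; rewrite ?MB //; apply/set0Pn; exists x; rewrite inE xJ.
- by rewrite properEneq KJ; case: eqVneq => [->|]; rewrite ?subxx ?orbT.
- by rewrite JK.
Qed.

Lemma sub_node (J : {set T}) : node M J \subset J.
Proof. exact: subsetDl. Qed.

(** Otherwise J is the union of the members of M properly inside it, and so is
    one of them. *)
Lemma node_neq0 (J : {set T}) : J \in M -> node M J != set0.
Proof.
have /nestedP[/subsetP MB M0 _ closedM] := nestedM.
move=> JM; rewrite setD_eq0; apply/negP => Jlow.
have lowE : lower M J = J by apply/eqP; rewrite eqEsubset lower_sub.
suff : J \in [set K in M | K \proper J] by rewrite inE properxx andbF.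
rewrite -{1}lowE; apply: closedM; last by rewrite -/(lower M J) lowE MB.
  by apply/subsetP => K; rewrite inE => /andP[].
apply: contraNneq M0 => e; suff <- : J = set0 by [].
by rewrite -lowE /lower e /cover big_set0.
Qed.

Lemma node_meet (J K : {set T}) (x : T) : J \in M -> K \in M ->
  x \in node M J -> x \in K -> J \subset K.
Proof.
move=> JM KM; rewrite inE => /andP[xlow xJ] xK.
have /orP[//|KJ] := nested_laminar JM KM xJ xK.
by case/lowerP: xlow; exists K.
Qed.

Lemma node_inj : {in M &, injective (node M)}.
Proof.
move=> J K JM KM e; have [x xJ] := set0Pn _ (node_neq0 JM).
have xK : x \in node M K by rewrite -e.
apply/eqP; rewrite eqEsubset (node_meet JM KM xJ) ?(node_meet KM JM xK) //.
  exact: (subsetP (sub_node J)).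
exact: (subsetP (sub_node K)).
Qed.

Lemma forest_of_edge (J R : {set T}) : J \in M ->
  (node M J, R) \in edges (forest_of M) ->
  exists2 K, covers M J K & R = node M K.
Proof.
move=> JM; rewrite inE => /existsP[J' /existsP[K /andP[JK /eqP[e ->]]]].
have /coversP[J'M _ _ _] := JK.
by exists K; rewrite // (node_inj JM J'M e).
Qed.

Lemma forest_of_edgeE (J K : {set T}) : covers M J K ->
  (node M J, node M K) \in edges (forest_of M).
Proof.
move=> JK; rewrite inE; apply/existsP; exists J; apply/existsP; exists K.
by rewrite JK eqxx.
Qed.

Lemma forest_of_le (J K : {set T}) : J \in M -> K \in M ->
  node_le (forest_of M) (node M J) (node M K) = (J \subset K).
Proof.
move=> JM KM; apply/idP/idP.
  case/connectP => p; elim: p J JM => [|R p IH] J JM /=.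
    by move=> _ /(node_inj KM JM) ->.
  case/andP => /(forest_of_edge JM)[L JL ->] pathp lastp.
  have /coversP[_ LM JpL _] := JL.
  by apply: subset_trans (proper_sub JpL) (IH L LM _ _).
have [n] := ubnP (#|K| - #|J|); elim: n J JM => // n IH J JM ltn JK.
have [->|nJK] := eqVneq J K; first exact: connect0.
have JpK : J \proper K by rewrite properEneq nJK.
have [L JL LK] := covers_exists JM KM JpK.
have /coversP[_ LM JpL _] := JL.
apply: (@connect_trans _ _ (node M L)).
  by apply: connect1; apply: forest_of_edgeE.
apply: IH => //; apply: leq_trans (_ : (#|K| - #|L| < #|K| - #|J|)%N) _ => //.
by rewrite ltn_sub2l ?proper_card.
Qed.

Lemma node_exists (J : {set T}) (x : T) : J \in M -> x \in J ->
  exists K, [/\ K \in M, K \subset J & x \in node M K].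
Proof.
move=> JM xJ; pose P := [pred K : {set T} | (K \in M) && (x \in K)].
have PJ : P J by rewrite /= JM.
case: (arg_minnP (fun K : {set T} => #|K|) PJ) => K /andP[KM xK] min.
have xnK : x \in node M K.
  rewrite inE xK andbT; apply/negP => /lowerP[L [LM /proper_card]].
  by rewrite ltnNge => LK xL; case/negP: LK; apply: min; rewrite /= LM.
exists K; split=> //; exact: node_meet xnK xJ.
Qed.

Lemma forest_of_down_le (J : {set T}) : J \in M ->
  down_le (forest_of M) (node M J) = J.
Proof.
move=> JM; apply/setP => x; apply/bigcupP/idP.
  case=> _ /andP[/imsetP[K KM ->]]; rewrite forest_of_le // => KJ.
  by move/(subsetP (sub_node K))/(subsetP KJ).
move=> /(node_exists JM)[K [KM KJ xK]]; exists (node M K) => //.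
by rewrite imset_f // forest_of_le.
Qed.

Lemma forest_ofK : down_sets (forest_of M) = M.
Proof.
rewrite /down_sets -imset_comp -[RHS]imset_id.
by apply: eq_in_imset => J JM /=; rewrite forest_of_down_le.
Qed.

Lemma forest_of_partition : partition (node M @: M) I.
Proof.
apply/and3P; split.
- rewrite -(nested_coverE bB nestedM); apply/eqP/setP => x.
  apply/bigcupP/bigcupP => -[].
    move=> _ /imsetP[J JM ->] xJ; exists J => //.
    exact: (subsetP (sub_node J)).
  move=> J JM /(node_exists JM)[K [KM _ xK]].
  by exists (node M K); rewrite ?imset_f.
- apply/trivIsetP => _ _ /imsetP[J JM ->] /imsetP[K KM ->].
  apply: contraR => /pred0Pn[x /andP[/= xJ xK]].
  apply/eqP; congr node; apply/eqP; rewrite eqEsubset.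
  rewrite (node_meet JM KM xJ) ?(node_meet KM JM xK) //.
    exact: (subsetP (sub_node J)).
  exact: (subsetP (sub_node K)).
- by apply/negP => /imsetP[J JM e]; have := node_neq0 JM; rewrite -e eqxx.
Qed.

Lemma forest_of_rooted : rooted_forest (forest_of M).
Proof.
have edgeP S R : (S, R) \in edges (forest_of M) ->
    exists J K, [/\ covers M J K, S = node M J & R = node M K].
  by rewrite inE => /existsP[J /existsP[K /andP[JK /eqP[-> ->]]]]; exists J, K.
apply/and3P; split.
- apply/subsetP => -[S R] /edgeP[J [K [/coversP[JM KM _ _] -> ->]]].
  by rewrite inE /= !imset_f.
- apply/'forall_forallP => S R; apply/forallP => R'; apply/implyP => /andP[].
  move=> /edgeP[J [K [/coversP[JM KM JK Kmin] -> ->]]].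
  move=> /(forest_of_edge JM)[K' /coversP[_ K'M JK' K'min] ->].
  have [x /(subsetP (sub_node J)) xJ] := set0Pn _ (node_neq0 JM).
  have xK := subsetP (proper_sub JK) x xJ.
  have xK' := subsetP (proper_sub JK') x xJ.
  have /orP[KK'|/proper_sub K'K] := nested_laminar KM K'M xK xK'.
    by rewrite (K'min K).
  by rewrite (Kmin K').
- apply/'forall_forallP => S R; apply/implyP.
  move=> /edgeP[J [K [/coversP[JM KM JK _] -> ->]]].
  by rewrite forest_of_le //; case/andP: JK.
Qed.

(** For (F2), note that a family containing its union is an antichain only if
    that union is its sole member.  For (F3), a member of M is a root when no
    member of M covers it, and as M contains the components of B these are the
    maximal members of M. *)
Lemma forest_of_Bforest : is_Bforest I B (forest_of M).
Proof.
have /nestedP[/subsetP MB M0 /subsetP compM closedM] := nestedM.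
apply/and5P; split; [exact: forest_of_rooted|exact: forest_of_partition|..].
- by apply/forall_inP => _ /imsetP[J JM ->]; rewrite forest_of_down_le ?MB.
- apply/forallP => A; apply/implyP.
  move=> /and3P[/subsetP AN card2 /forall_inP anti].
  pose A' := [set J in M | node M J \in A].
  have coverA : \bigcup_(S in A) down_le (forest_of M) S = cover A'.
    apply/setP => x; apply/bigcupP/bigcupP => -[].
      move=> S SA; have /imsetP[J JM S_eq] := AN S SA.
      rewrite S_eq forest_of_down_le // => xJ; exists J; rewrite // inE JM.
      by rewrite -S_eq.
    move=> J; rewrite inE => /andP[JM JA] xJ; exists (node M J) => //.
    by rewrite forest_of_down_le.
  rewrite coverA; apply/negP => A'B.
  have /card_gt1P[S [R [SA RA nSR]]] := card2.
  have /imsetP[J JM S_eq] := AN S SA.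
  have : cover A' \in A'.
    apply: closedM => //; first by apply/subsetP => K; rewrite inE => /andP[].
    by apply/set0Pn; exists J; rewrite inE JM -S_eq.
  rewrite inE => /andP[CM CA].
  have single Q : Q \in A -> Q = node M (cover A').
    move=> QA; have /imsetP[K KM Q_eq] := AN Q QA.
    apply/eqP; apply: contraT => nQ.
    have /forall_inP/(_ _ CA)/implyP/(_ nQ)/andP[/negP QC _] := anti Q QA.
    case: QC; rewrite Q_eq forest_of_le //; apply: (bigcup_sup K) => //.
    by rewrite inE KM -Q_eq.
  by case/eqP: nSR; rewrite (single S) // (single R).
- apply/eqP/setP => J; apply/imsetP/idP => [[S]|JC].
    rewrite inE => /andP[/imsetP[K KM ->] /forallP noedge] ->.
    rewrite forest_of_down_le //.
    have [|c cC Kc] := component_exists (MB K KM).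
      by apply: contraNneq M0 => <-.
    have [->//|nKc] := eqVneq K c.
    have [|L KL _] := covers_exists KM (compM c cC).
      by rewrite properEneq nKc.
    by case/negP: (noedge (node M L)); apply: forest_of_edgeE.
  have [_ _ Jmax] := componentsP JC; have JM := compM J JC.
  exists (node M J); rewrite ?forest_of_down_le // inE imset_f //=.
  apply/forallP => R; apply/negP => /(forest_of_edge JM)[K].
  case/coversP => _ KM JK _ _; move: (JK).
  by rewrite (Jmax K) ?MB ?proper_sub // properxx.
Qed.

End NestedToForest.

Lemma sum_Bforests (T : finType) (I : {set T}) (B : {set {set T}})
    (R : pzRingType) (phi : {set {set T}} -> R) :
  building I B ->
  \sum_(N | is_Bforest I B N) (-1) ^+ #|nodes N| * phi (forest_sets B N) =
  \sum_(M | nested B M) (-1) ^+ #|M| * phi (nested_sets B M).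
Proof.
move=> bB; rewrite (reindex_onto (@forest_of T) (@down_sets T)) /=; last first.
  by move=> N; apply: down_setsK.
apply: eq_big => [M|M /andP[forestM /eqP M_eq]].
  apply/andP/idP => [[forestM /eqP <-]|nestedM].
    exact: down_sets_nested forestM.
  by rewrite (forest_of_Bforest bB nestedM) (forest_ofK bB nestedM).
by rewrite -(card_down_sets forestM) -(nested_sets_down_sets forestM) M_eq.
Qed.

(** The piece B[N_{<S}, N_{<=S}] has ground set S and contains S, because
    N_{<=S} is in B. *)
Lemma components_forest_sets (T : finType) (I : {set T}) (B : {set {set T}})
    (N : setgraph T) :
  is_Bforest I B N -> components (forest_sets B N) = nodes N.
Proof.
move=> forestN; have /and5P[_ pN /forall_inP F1 _ _] := forestN.
have /and3P[_ _ n0] := pN.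
have nodeF S : S \in nodes N -> S \in forest_sets B N.
  move=> SN; rewrite inE; apply/orP; right; apply/bigcupP; exists S => //.
  rewrite inE (down_leD pN SN) subxx; apply/existsP; exists (down_lt N S).
  have lt_le : down_lt N S \subset down_le N S.
    apply/bigcupsP => R /and3P[RN _ RS]; apply: (bigcup_sup R) => //.
    by rewrite RN.
  rewrite subxx inE; have -> : down_lt N S :|: S = down_le N S.
    by rewrite -{2}(down_leD pN SN) -{1}(setIidPr lt_le) setID.
  by rewrite F1 ?subxx.
have subF J : J \in forest_sets B N -> J != set0 ->
    exists2 S, S \in nodes N & J \subset S.
  rewrite inE => /orP[/set1P -> /eqP //|/bigcupP[S SN]].
  by rewrite inE (down_leD pN SN) => /andP[JS _] _; exists S.
apply/setP => J; apply/idP/idP => [/componentsP[J0 JF Jmax]|JN].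
  have [S SN JS] := subF J JF J0.
  by rewrite -(Jmax S (nodeF S SN) JS).
have J0 : J != set0 by apply: contraNneq n0 => <-.
rewrite inE J0; apply/maxsetP; split=> [|K KF JK]; first exact: nodeF.
have [|S SN KS] := subF K KF.
  by apply: contraNneq J0 => K0; rewrite -subset0 -K0.
have [x xJ] := set0Pn _ J0.
have JS : J = S.
  exact: (node_disjoint forestN JN SN xJ (subsetP (subset_trans JK KS) x xJ)).
by apply/eqP; rewrite eqEsubset JK {1}JS KS.
Qed.

(** * The alternating sum over set compositions *)

(** The building set obtained from B by applying the iterated coproduct along s
    and then the iterated product ([val_iter_product_coproduct]). *)
Fixpoint composition_sets (T : finType) (B : {set {set T}})
    (s : seq {set T}) : {set {set T}} :=
  if s is C :: s' then
    restriction B C :|: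
      composition_sets (contraction B C (\bigcup_(A <- s') A)) s'
  else [set set0].

Lemma val_iter_product_coproduct (T : finType) (I : {set T})
    (s : seq {set T}) (c : set_composition I s) (B : BS I) :
  val (BS_iter_product c (BS_iter_coproduct c B)) = composition_sets (val B) s.
Proof. by elim: s I c B => [|S s IH] I c B //=; rewrite IH. Qed.

(** Coassociativity: the iterated coproduct, defined by splitting off the first
    block, can also be computed by splitting off the last one. *)
Lemma composition_sets_rcons (T : finType) (B : {set {set T}})
    (s : seq {set T}) (R : {set T}) (S := \bigcup_(A <- s) A) :
  composition_sets B (rcons s R) =
  composition_sets (restriction B S) s :|: contraction B S R.
Proof.
rewrite {}/S; elim: s B => [|S s IH] B.
  rewrite /= !big_nil setUC; congr (_ :|: _); apply/setP => J.
  rewrite !inE andbC; congr (_ && _); apply/idP/existsP => [JB|[A]].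
    by exists set0; rewrite sub0set set0U.
  by rewrite subset0 => /andP[/eqP ->]; rewrite set0U.
rewrite /= IH big_rcons /= big_cons setUA.
set S' := \bigcup_(A <- s) A; congr (_ :|: composition_sets _ s :|: _).
- apply/setP => J; rewrite !inE -andbA; congr (_ && _).
  by rewrite andb_idl // => /subset_trans; apply; apply: subsetUl.
- apply/setP => J; rewrite !inE.
  apply/andP/andP => [[/andP[_ /existsP[A]]]|[JS' /existsP[A]]].
    case/andP => AS AJB JS'; split=> //; apply/existsP; exists A.
    by rewrite inE AS AJB setUSS.
  rewrite inE => /and3P[AS AJB _]; split=> //; apply/andP; split.
    exact: subset_trans (subsetUl _ _).
  by apply/existsP; exists A; rewrite AS.
- apply/setP => J; rewrite !inE; apply: andb_id2l => JR.
  apply/existsP/existsP => -[A /andP[AS]].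
    rewrite inE => /andP[_ /existsP[A' /andP[A'S AJB]]].
    by exists (A' :|: A); rewrite setUSS // -setUA.
  move=> AJB; exists (A :&: S'); rewrite subsetIr inE /=; apply/andP; split.
    by rewrite setUSS ?subsetIr.
  apply/existsP; exists (A :&: S).
  by rewrite subsetIr setUA -setIUr (setIidPl AS).
Qed.

Lemma set_composition_rcons (T : finType) (I R : {set T}) (s : seq {set T}) :
  set_composition I (rcons s R) =
  [&& R != set0, R \subset I & set_composition (I :\: R) s].
Proof.
rewrite /set_composition mem_rcons inE negb_or eq_sym.
rewrite pairwise_rcons big_rcons /=.
set U := \bigcup_(A <- s) A.
have -> : all (fun A : {set T} => [disjoint A & R]) s = (U :&: R == set0).
  rewrite /U setI_eq0; elim: (s) => [|A r IH] /=.
    by rewrite big_nil -setI_eq0 set0I eqxx.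
  by rewrite big_cons IH -!setI_eq0 setIUl setU_eq0.
have : (R :|: U == I) && (U :&: R == set0) = (R \subset I) && (U == I :\: R).
  apply/andP/andP => [[/eqP <- /eqP UR]|[RI /eqP ->]].
    rewrite subsetUl setDUl setDv set0U eqEsubset subsetDl subsetD subxx.
    by rewrite -setI_eq0 UR eqxx.
  rewrite -{2}(setID I R) (setIidPr RI) eqxx.
  by rewrite setI_eq0 disjoints_subset setDE subsetIr.
case: (R != set0) => //; case: (set0 \notin s); rewrite ?andbF //=.
by case: (pairwise _ s); rewrite ?andbF //= ?andbT setUC andbC => ->.
Qed.

Lemma building_set0 (T : finType) (I : {set T}) (B : {set {set T}}) :
  I = set0 -> building I B -> B = [set set0].
Proof.
move=> I0 /buildingP[subI B0 _ _]; apply/eqP.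
rewrite eqEsubset sub1set B0 andbT; apply/subsetP => J /subI.
by rewrite I0 subset0 inE.
Qed.

Section Takeuchi.
Variables (T : finType) (K : pzRingType).
Implicit Types (phi : {set {set T}} -> K) (I : {set T}) (B : {set {set T}}).

Definition composition_sum phi I B k : K :=
  \sum_(s : k.-tuple {set T} | set_composition I s) phi (composition_sets B s).

Lemma composition_sum0 phi I B :
  composition_sum phi I B 0 = if I == set0 then phi [set set0] else 0.
Proof.
rewrite /composition_sum (eq_bigl (fun _ => I == set0)) => [|s].
  case: eqP => _; last by rewrite big_pred0.
  by rewrite (big_pred1 [tuple]) // => s; apply/esym/eqP/tuple0.
by rewrite (tuple0 s) /set_composition /= big_nil eq_sym.
Qed.

Lemma rcons_tuple_bij k :
  bijective (fun p : k.-tuple {set T} * {set T} => rcons_tuple p.1 p.2).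
Proof.
apply: inj_card_bij => [[s S] [s' S'] /(congr1 val)/rcons_inj[ss' ->]|].
  by congr pair; apply: val_inj.
by rewrite card_prod !card_tuple expnSr.
Qed.

Lemma composition_sumS phi I B k :
  composition_sum phi I B k.+1 =
  \sum_(S : {set T} | S \proper I)
     composition_sum (fun X => phi (X :|: contraction B S (I :\: S)))
       S (restriction B S) k.
Proof.
rewrite /composition_sum (reindex _ (onW_bij _ (rcons_tuple_bij k))) /=.
rewrite -(pair_big_dep xpredT
  (fun (s : k.-tuple {set T}) R => set_composition I (rcons s R))
  (fun s R => phi (composition_sets B (rcons s R)))) /=.
rewrite [RHS](exchange_big_dep xpredT) //=; apply: eq_bigr => s _.
rewrite (reindex_onto (fun S => I :\: S) (fun R => I :\: R)) /=; last first.
  move=> R; rewrite set_composition_rcons => /and3P[_ RI _].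
  by rewrite setDDr setDv set0U (setIidPr RI).
apply: eq_big => [S|S /andP[sI /eqP S_eq]].
  rewrite set_composition_rcons subsetDl /= setDDr setDv set0U setD_eq0.
  rewrite properE; apply/andP/andP => [[/andP[-> sS] /eqP IS]|].
    by rewrite -IS subsetIl; move: sS; rewrite IS.
  by case=> /andP[/setIidPr -> ->] ->; rewrite eqxx.
move: sI; rewrite set_composition_rcons S_eq => /and3P[_ _ /and3P[_ _ /eqP Ss]].
by rewrite composition_sets_rcons Ss.
Qed.

(** Induction on the bound n for the number of blocks: splitting off the last
    block lowers the bound by one and replaces I by a proper subset S, so the
    bound stays above the cardinal.  What remains to be checked is that the sum
    over nested sets obeys the same recursion, which for nonempty I is the vanishing
    of its sum over all subsets S, the term S = I being the sum for B. *)
Lemma sum_compositions phi I B n : building I B -> (#|I| < n)%N ->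
  \sum_(k < n) (-1) ^+ k * composition_sum phi I B k =
  \sum_(M | nested B M) (-1) ^+ #|M| * phi (nested_sets B M).
Proof.
elim: n phi I B => // n IH phi I B bB ltIn.
rewrite big_ord_recl expr0 mul1r composition_sum0.
under eq_bigr => k _ do rewrite composition_sumS exprS mulN1r mulNr mulr_sumr.
rewrite sumrN exchange_big /=.
have {}IH (S : {set T}) : S \proper I ->
    \sum_(k < n) (-1) ^+ k *
      composition_sum (fun X => phi (X :|: contraction B S (I :\: S)))
        S (restriction B S) k =
    \sum_(M | nested (restriction B S) M) (-1) ^+ #|M| *
      phi (nested_sets (restriction B S) M :|: contraction B S (I :\: S)).
  move=> SI; rewrite (IH (fun X => phi (X :|: contraction B S (I :\: S)))) //.
    exact: restriction_building (proper_sub SI) bB.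
  by apply: leq_trans (proper_card SI) _.
rewrite (eq_bigr _ IH); have [I0|I0] := eqVneq I set0.
  rewrite I0 big_pred0 ?oppr0 ?addr0 => [|S]; last first.
    by rewrite properE sub0set andbF.
  have BE := building_set0 I0 bB.
  rewrite (big_pred1 set0) => [|M].
    by rewrite cards0 mul1r /nested_sets big_set0 setU0.
  apply/idP/eqP => [/nestedP[MB M0 _ _]|->].
    apply/eqP; rewrite -subset0; apply/subsetP => J JM.
    have := subsetP MB J JM; rewrite BE inE => /eqP J0.
    by rewrite J0 (negPf M0) in JM.
  apply/nestedP; split; rewrite ?sub0set ?inE //.
    apply/subsetP => J /componentsP[J0]; rewrite BE inE => /eqP J0'.
    by rewrite J0' eqxx in J0.
  by move=> A; rewrite subset0 => /eqP ->; rewrite eqxx.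
rewrite add0r; apply/eqP; rewrite eq_sym -addr_eq0; apply/eqP.
rewrite -[RHS](nested_sum_eq0 bB phi I0) [RHS](bigD1 I) //=; congr (_ + _).
  have restrI : restriction B I = B.
    apply/setP => J; rewrite inE andb_idr //.
    by have /buildingP[subI _ _ _] := bB; apply: subI.
  rewrite restrI; apply: eq_bigr => M _; congr (_ * phi _).
  rewrite setDv; apply/setP => H; rewrite !inE subset0.
  by case: (H == set0); rewrite /= ?orbF.
by apply: eq_bigl => S; rewrite properEneq andbC.
Qed.

End Takeuchi.

(** * The antipode *)

Lemma sum_sig (R : nmodType) (X : finType) (P : pred X) (F : X -> R) :
  \sum_(x : {x | P x}) F (val x) = \sum_(x | P x) F x.
Proof.
rewrite [RHS](reindex_omap (val : {x | P x} -> X) insub) => [|x Px].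
  by apply: eq_bigl => -[x Px] /=; rewrite insubT Px /= eqxx.
by rewrite insubT.
Qed.

Lemma linearize_basis (K : fieldType) (X Y : finType) (f : X -> Y) (x : X) :
  linearize f (basis_vect K x) = basis_vect K (f x).
Proof.
rewrite /linearize (bigD1 x) //= big1 ?addr0 => [|y nyx].
  by rewrite ffunE eqxx scale1r.
by rewrite ffunE (negPf nyx) scale0r.
Qed.

(** Both sides are compared coefficientwise, the coefficient at C being the case
    where phi is the indicator function of C. *)
Lemma antipode_basis (K : fieldType) (T : finType) (I : {set T}) (B : BS I) :
  antipode (basis_vect K B) =
  \sum_(N : Bforest B) (forest_coef N)%:~R *: basis_vect K (forest_BS N).
Proof.
apply/ffunP => C; pose phi X : K := (X == val C)%:R.
have basisE (X : BS I) : (basis_vect K X : {ffun _ -> K^o}) C = phi (val X).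
  by rewrite ffunE /phi -val_eqE eq_sym.
have coefE (A : finType) (c : A -> K) (X : A -> BS I) :
    (\sum_a c a *: basis_vect K (X a) : {ffun _ -> K^o}) C =
    \sum_a c a * phi (val (X a)).
  by rewrite sum_ffunE; apply: eq_bigr => a _; rewrite -basisE [LHS]ffunE.
rewrite coefE /=.
under eq_bigr => N _ do rewrite /forest_coef rmorphXn rmorphN1.
rewrite (sum_sig (is_Bforest I (val B))
  (fun N => (-1) ^+ #|nodes N| * phi (forest_sets (val B) N))).
rewrite (sum_Bforests phi (valP B)).
rewrite -(sum_compositions phi (valP B) (ltnSn _)) big_ord_recl.
rewrite expr0 mul1r composition_sum0 /antipode.
have [I0|I0] := eqVneq I set0.
  rewrite basisE big1 ?addr0 => [|k _].
    by rewrite (building_set0 I0 (valP B)).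
  rewrite composition_sumS big1 ?mulr0 // => S.
  by rewrite properE => /andP[_]; rewrite {1}I0 sub0set.
rewrite add0r sum_ffunE big_add1 big_mkord; apply: eq_bigr => k _.
rewrite /composition_sum -(sum_sig
  (fun s : k.+1.-tuple _ => set_composition I s)
  (fun s => phi (composition_sets (val B) s))) sum_ffunE mulr_sumr.
apply: eq_bigr => s _; rewrite /Delta_iter /mu_iter !linearize_basis.
by rewrite ffunE basisE val_iter_product_coproduct.
Qed.

Lemma forest_cancellation_free (T : finType) (I : {set T}) (B : BS I) :
  cancellation_free (@forest_coef T I B) (@forest_BS T I B).
Proof.
move=> N N' _ /(congr1 val)/(congr1 (@components T)) /=.
rewrite (components_forest_sets (valP N)) (components_forest_sets (valP N')).
by rewrite /forest_coef => ->; rewrite -expr2 sqrr_sign.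
Qed.

Theorem corollary22p9 (K : fieldType) (charK : [pchar K] =i pred0)
    (T : finType) (I : {set T}) (B : BS I) :
  antipode (basis_vect K B) =
    \sum_(N : Bforest B) (forest_coef N)%:~R *: basis_vect K (forest_BS N)
  /\ cancellation_free (@forest_coef T I B) (@forest_BS T I B).
Proof.
by split; [apply: antipode_basis | apply: forest_cancellation_free].
Qed.
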